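(* Let $n$ be a positive integer, and let $\mathfrak{h}$ be the Cartan subalgebra of $\mathfrak{sl}_n=\mathfrak{sl}_n(\mathbb{C})$ consisting of traceless diagonal matrices, with representation rings $R(\mathfrak{h})=\mathbb{Z}[x_1,\dots,x_n]/(x_1x_2\cdots x_n-1)$ and $R(\mathfrak{sl}_n)=\mathbb{Z}[s_1,\dots,s_n]/(x_1x_2\cdots x_n-1)\subset R(\mathfrak{h})$, where $s_i$ is the $i$-th elementary symmetric polynomial in $x_1,\dots,x_n$. Then $R(\mathfrak{h})$ is a free module over $R(\mathfrak{sl}_n)$, and a basis is given by $$\left\{\prod_{i=1}^{n} x_i^{a_i} \;:\; 0\le a_i\le n-i \text{ for } 1\le i\le n\right\}.$$
   Context: The representation ring of $\mathfrak{sl}_n$ (equivalently of $SU_n$) is the Grothendieck ring of its finite-dimensional complex representations under direct sum and tensor product. $R(\mathfrak{h})$ denotes the representation ring of the maximal torus $T$ of $SU_n$, that is, the integral group ring $\mathbb{Z}[\Lambda]$ of the weight lattice $\Lambda$. Here $x_i$ is the class of the weight $L_i\in \mathfrak{h}^*$ sending a diagonal matrix to its $i$-th diagonal entry; the relation $L_1+\dots+L_n=0$ becomes $x_1\cdots x_n=1$. Via restriction to the torus (the character map), $R(\mathfrak{sl}_n)$ is identified with the subring $\mathbb{Z}[\Lambda]^{W}$ of invariants under the Weyl group $W\cong S_n$ permuting the $x_i$. This is the subring of $R(\mathfrak{h})$ generated by the images of the elementary symmetric polynomials $s_1=\sum_i x_i,\ s_2=\sum_{i<j}x_ix_j,\ \dots,\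 s_n=x_1\cdots x_n=1$. The $R(\mathfrak{sl}_n)$-module structure on $R(\mathfrak{h})$ is the one given by this inclusion. *)

(* Defs.v *)
From HB Require Import structures.
From mathcomp Require Import all_boot all_algebra ring_quotient.
From mathcomp Require Import boolp.
From mathcomp Require Import mpoly.

Set Implicit Arguments.
Unset Strict Implicit.
Unset Printing Implicit Defensive.

Import GRing.Theory.

Local Open Scope ring_scope.
Local Open Scope quotient_scope.

(* Module bases, for an arbitrary (possibly infinite) index type: finite linear
   combinations are sums over duplicate-free sequences of indices. *)
Section Basis.
Variables (R : nzRingType) (M : lmodType R).

Definition spanning (I : eqType) (b : I -> M) : Prop :=
  forall m : M, exists (s : seq I) (c : I -> R), m = \sum_(i <- s) c i *: b i.

Definition lin_independent (I : eqType) (b : I -> M) : Prop :=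
  forall (s : seq I) (c : I -> R), uniq s ->
    \sum_(i <- s) c i *: b i = 0 -> {in s, forall i, c i = 0}.

Definition is_basis (I : eqType) (b : I -> M) : Prop :=
  spanning b /\ lin_independent b.

Definition is_free_module : Prop :=
  exists (I : eqType) (b : I -> M), is_basis b.
End Basis.

(* The principal ideal (x_1 ... x_n - 1) of Z[x_1, ..., x_n]. *)
Section TorusIdeal.
Variable n : nat.

Definition torus_rel : {mpoly int[n]} := \prod_(i < n) 'X_i - 1.

Definition torus_ideal : {pred {mpoly int[n]}} :=
  fun p => `[< exists q : {mpoly int[n]}, p = q * torus_rel >].

Fact torus_ideal_closed : idealr_closed torus_ideal.
Proof.
split.
- by apply/asboolP; exists 0; rewrite mul0r.
- apply/asboolP => -[q /(congr1 (meval (fun=> 1)))].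
  rewrite /torus_rel rmorph1 rmorphM rmorphB rmorph1 rmorph_prod.
  rewrite big1 => [|i _]; last by rewrite /= mevalXU.
  by rewrite subrr mulr0 => /eqP; rewrite oner_eq0.
- move=> a u v /asboolP[p ->] /asboolP[q ->]; apply/asboolP.
  by exists (a * p + q); rewrite mulrDl mulrA.
Qed.

HB.instance Definition _ :=
  isIdealr.Build {mpoly int[n]} torus_ideal torus_ideal_closed.

End TorusIdeal.

(* R(h) = Z[x_1, ..., x_n] / (x_1 ... x_n - 1). *)
Definition Rh (n : nat) : Type := {ideal_quot (@torus_ideal n)}.
HB.instance Definition _ (n : nat) := GRing.ComNzRing.on (Rh n).

Definition to_Rh (n : nat) (p : {mpoly int[n]}) : Rh n :=
  \pi_({ideal_quot (@torus_ideal n)}) p.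

Fact to_Rh_zmod_morphism n : zmod_morphism (@to_Rh n).
Proof. exact: rmorphB. Qed.

Fact to_Rh_monoid_morphism n : monoid_morphism (@to_Rh n).
Proof. by split; [exact: rmorph1 | exact: rmorphM]. Qed.

HB.instance Definition _ n :=
  GRing.isZmodMorphism.Build _ _ (@to_Rh n) (@to_Rh_zmod_morphism n).
HB.instance Definition _ n :=
  GRing.isMonoidMorphism.Build _ _ (@to_Rh n) (@to_Rh_monoid_morphism n).

(* The generator x_{i+1} of R(h): indices in 'I_n start at 0. *)
Definition x_ (n : nat) (i : 'I_n) : Rh n := to_Rh 'X_i.

(* Membership in the image of Z[s_1, ..., s_n] in R(h). *)
Definition sl_pred (n : nat) : {pred Rh n} :=
  fun r => `[< exists q : {mpoly int[n]},
    r = to_Rh (q \mPo [tuple mesym n int i.+1 | i < n]) >].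

Fact sl_subring_closed n : subring_closed (@sl_pred n).
Proof.
split.
- by apply/asboolP; exists 1; rewrite !rmorph1.
- move=> u v /asboolP[p ->] /asboolP[q ->]; apply/asboolP.
  by exists (p - q); rewrite !rmorphB.
- move=> u v /asboolP[p ->] /asboolP[q ->]; apply/asboolP.
  by exists (p * q); rewrite !rmorphM.
Qed.

HB.instance Definition _ n :=
  GRing.isSubringClosed.Build (Rh n) (@sl_pred n) (@sl_subring_closed n).

(* R(sl_n), as a subring of R(h). *)
Record Rsl (n : nat) : Type :=
  MkRsl { Rsl_val :> Rh n; RslP : Rsl_val \in @sl_pred n }.

HB.instance Definition _ n := [isSub for @Rsl_val n].
HB.instance Definition _ n := [Choice of Rsl n by <:].
HB.instance Definition _ n := [SubChoice_isSubComNzRing of Rsl n by <:].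

(* The R(sl_n)-module structure of R(h) is multiplication through the inclusion. *)
Section RslModule.
Variable n : nat.

Definition Rsl_scale (c : Rsl n) (r : Rh n) : Rh n := Rsl_val c * r.

Fact Rsl_scaleA a b v : Rsl_scale a (Rsl_scale b v) = Rsl_scale (a * b) v.
Proof. exact: mulrA. Qed.
Fact Rsl_scale1 : left_id 1 Rsl_scale.
Proof. exact: mul1r. Qed.
Fact Rsl_scaleDr : right_distributive Rsl_scale +%R.
Proof. by move=> a u v; exact: mulrDr. Qed.
Fact Rsl_scaleDl v : {morph Rsl_scale^~ v : a b / a + b}.
Proof. by move=> a b; exact: mulrDl. Qed.

HB.instance Definition _ := GRing.Zmodule_isLmodule.Build (Rsl n) (Rh n)
  Rsl_scaleA Rsl_scale1 Rsl_scaleDr Rsl_scaleDl.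

End RslModule.

(* The exponent vectors (a_1, ..., a_n) with 0 <= a_i <= n - i; with indices
   starting at 0 the bound reads a i <= n - i.+1, so 'I_n is a large enough
   codomain. *)
Definition staircase (n : nat) : finType :=
  {a : {ffun 'I_n -> 'I_n} | [forall i, (a i <= n - i.+1)%N]}.

Definition staircase_monomial (n : nat) (a : staircase n) : Rh n :=
  \prod_(i < n) x_ i ^+ (val a i).

(* Main.v *)
Require Import Defs.
From mathcomp Require Import all_boot all_algebra.
From HB Require Import structures.
From mathcomp Require Import perm boolp generic_quotient ring_quotient mpoly.
From mathcomp Require Import zify.

Set Implicit Arguments.
Unset Strict Implicit.
Unset Printing Implicit Defensive.

Import GRing.Theory.

Local Open Scope ring_scope.

(** Over Z[x_1, ..., x_n], let A_k be the ring generated by the symmetric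
    polynomials and x_1, ..., x_k. The monic polynomial prod_(l > k) (X - x_l)
    of degree n - k has its coefficients in A_k (divide prod_l (X - x_l)
    successively by X - x_1, ..., X - x_k) and vanishes at x_(k+1), so
    1, x_(k+1), ..., x_(k+1)^(n-k-1) span A_(k+1) over A_k. They are independent:
    a relation, conjugated by the transpositions (k+1 l), is a polynomial of
    degree < n - k with the n - k distinct roots x_l, l > k. Multiplying out this
    tower, the staircase monomials form a basis of Z[x_1, ..., x_n] over the
    symmetric polynomials. This passes to the quotient by x_1 ... x_n - 1
    because that element is itself symmetric: expanding the cofactor q of
    sum_a f_a x^a = q (x_1 ... x_n - 1) on the basis shows that every f_a lies in
    the ideal. *)

(** * Adjoining one element to a subring, and division by a monic polynomial *)

Section Adjoin.
Variables (R : comNzRingType) (S : subringClosed R) (x : R).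

Definition adjoin : {pred R} :=
  fun p => `[< exists2 P : {poly R}, P \is a polyOver S & p = P.[x] >].

Fact adjoin_subring_closed : subring_closed adjoin.
Proof.
split.
- by apply/asboolP; exists 1; rewrite ?rpred1 ?hornerC.
- move=> _ _ /asboolP[P PS ->] /asboolP[Q QS ->]; apply/asboolP.
  by exists (P - Q); rewrite ?rpredB // hornerD hornerN.
- move=> _ _ /asboolP[P PS ->] /asboolP[Q QS ->]; apply/asboolP.
  by exists (P * Q); rewrite ?rpredM // hornerM.
Qed.

HB.instance Definition _ :=
  GRing.isSubringClosed.Build R adjoin adjoin_subring_closed.

Lemma sub_adjoin : {subset S <= adjoin}.
Proof.
by move=> p pS; apply/asboolP; exists p%:P; rewrite ?polyOverC ?hornerC.
Qed.

Lemma mem_adjoin : x \in adjoin.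
Proof. by apply/asboolP; exists 'X; rewrite ?polyOverX ?hornerX. Qed.

(** Division by [Q] stays over [S] because [Q] is monic, and the multiple of [Q] that is discarded
    vanishes at [x]. *)
Lemma polyOver_reduce (Q : {poly R}) :
    Q \is monic -> Q \is a polyOver S -> root Q x ->
  forall P : {poly R}, P \is a polyOver S ->
  exists r : {poly R},
    [/\ r \is a polyOver S, (size r < size Q)%N & P.[x] = r.[x]].
Proof.
move=> Qmon QS /rootP Qx P; move: {2}(size P).+1 (ltnSn (size P)) => m.
elim: m P => // m IH P ltPm PS.
have [ltPQ | leQP] := ltnP (size P) (size Q); first by exists P.
have Q0 : (0 < size Q)%N by rewrite size_poly_gt0 monic_neq0.
pose T := lead_coef P *: 'X^(size P - size Q) * Q.
have TS : T \is a polyOver S.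
  rewrite rpredM // polyOverZ ?polyOverXn //.
  exact: (polyOverP PS).
have ltPT : (size (P - T)%R < size P)%N.
  have P0 : (0 < size P)%N by apply: leq_trans leQP.
  rewrite -[ltnRHS]prednK // ltnS; apply/leq_sizeP => j.
  rewrite leq_eqVlt => /orP[/eqP<- | ltPj].
    rewrite coefB /T -scalerAl coefZ coefXnM.
    have -> : ((size P).-1 < size P - size Q)%N = false by lia.
    have -> : ((size P).-1 - (size P - size Q) = (size Q).-1)%N by lia.
    by rewrite -!/(lead_coef _) (monicP Qmon) mulr1 subrr.
  have {}ltPj : (size P <= j)%N := leq_trans (leqSpred _) ltPj.
  rewrite coefB /T -scalerAl coefZ coefXnM [P`_j]nth_default //.
  case: ifP => [|_]; first by rewrite mulr0 subrr.
  rewrite [Q`_(_)]nth_default ?mulr0 ?subrr //.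
  by rewrite -{1}(subKn leQP) leq_sub2r.
have [||r [rS ltrQ Er]] := IH (P - T); first by lia.
  by rewrite rpredB.
exists r; split=> //.
by rewrite -Er hornerD hornerN /T hornerM Qx mulr0 subr0.
Qed.

(** Each coefficient of [q] is determined by the next one and a coefficient of the product, so
    membership in [S] descends from above the degree, where the coefficients are 0. *)
Lemma polyOver_XsubC_factor (q : {poly R}) (c : R) :
  c \in S -> q * ('X - c%:P) \is a polyOver S -> q \is a polyOver S.
Proof.
move=> cS /polyOverP qS; apply/polyOverP => i.
have [m] : exists m, (size q <= i + m)%N by exists (size q); lia.
elim: m i => [|m IH] i leqim.
  by rewrite addn0 in leqim; rewrite nth_default ?rpred0.
have -> : q`_i = (q * ('X - c%:P))`_i.+1 + q`_i.+1 * c.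
  by rewrite mulrBr coefB coefMX coefMC /= subrK.
by rewrite rpredD ?rpredM ?qS // IH // addSnnS.
Qed.

End Adjoin.

(** * Staircase exponent vectors, one variable at a time *)

(* Indices start at 0 and there are n + 1 variables, so the bound n - i on the
   i-th exponent is the one of Defs for n.+1. *)
Section Staircase.
Variables (n : nat) (R : comNzRingType) (x : 'I_n.+1 -> R).
Implicit Types (k : nat) (a : {ffun 'I_n.+1 -> 'I_n.+1}).

(** Exponents of the monomials that will span level [k] of the tower over its base; at [k = n.+1]
    this is the full staircase. *)
Definition stair k : pred {ffun 'I_n.+1 -> 'I_n.+1} :=
  fun a => [forall i, (a i <= n - i)%N && ((k <= i)%N ==> (a i == 0%N :> nat))].

Definition stairX a : R := \prod_i x i ^+ a i.

Definition set_exp a (k : 'I_n.+1) (j : 'I_n.+1) :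
  {ffun 'I_n.+1 -> 'I_n.+1} := [ffun i => if i == k then j else a i].

Lemma stair0P a : reflect (a = [ffun=> ord0]) (stair 0 a).
Proof.
apply: (iffP forallP) => [a0 | -> i]; last by rewrite ffunE.
apply/ffunP => i; rewrite ffunE; apply/val_inj/eqP.
by have /andP[_] := a0 i.
Qed.

Lemma stairX_set_exp a (k j : 'I_n.+1) :
  stair k a -> stairX (set_exp a k j) = stairX a * x k ^+ j.
Proof.
move=> /forallP/(_ k)/andP[_]; rewrite leqnn => /eqP ak.
rewrite /stairX (bigD1 k) //= [in RHS](bigD1 k) //= ffunE eqxx ak.
rewrite expr0 mul1r mulrC; congr (_ * _); apply: eq_bigr => i ik.
by rewrite ffunE (negPf ik).
Qed.

Lemma stair_set_exp a (k j : 'I_n.+1) :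
  (j <= n - k)%N -> stair k a -> stair k.+1 (set_exp a k j).
Proof.
move=> lejk /forallP ka; apply/forallP => i; rewrite ffunE.
have [-> | ik] := eqVneq i k; first by rewrite lejk ltnn.
have /andP[-> /implyP ai] := ka i; apply/implyP => ki.
by apply: ai; lia.
Qed.

Lemma set_exp_set (k : 'I_n.+1) a i j :
  set_exp (set_exp a k i) k j = set_exp a k j.
Proof. by apply/ffunP => l; rewrite !ffunE; case: eqP. Qed.

Lemma set_exp_id (k : 'I_n.+1) a : set_exp a k (a k) = a.
Proof. by apply/ffunP => l; rewrite ffunE; case: eqP => [->|]. Qed.

Lemma set_exp0 (k : 'I_n.+1) a : stair k a -> set_exp a k ord0 = a.
Proof.
move=> /forallP/(_ k)/andP[_]; rewrite leqnn => /eqP ak.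
by rewrite -[RHS](set_exp_id k); congr set_exp; apply/val_inj.
Qed.

Lemma stair_set_exp0 (k : 'I_n.+1) a :
  stair k.+1 a -> stair k (set_exp a k ord0).
Proof.
move=> /forallP ka; apply/forallP => i; rewrite ffunE.
have [-> // | ik] := eqVneq i k; first by rewrite implybT.
have /andP[-> /implyP ai] := ka i; apply/implyP => ki.
by apply: ai; rewrite ltn_neqAle eq_sym ik.
Qed.

Lemma stair_ltn (k : 'I_n.+1) a : stair k.+1 a -> (a k < (n - k).+1)%N.
Proof. by move=> /forallP/(_ k)/andP[]; rewrite ltnS. Qed.

(** The bijection behind multiplying out the tower: a vector of level [k.+1] amounts to its entry at
    [k] together with the vector of level [k] obtained by resetting that entry to 0. *)
Lemma big_stair_recr (V : nmodType) (k : 'I_n.+1)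
    (F : {ffun 'I_n.+1 -> 'I_n.+1} -> V) :
  \sum_(a | stair k.+1 a) F a =
  \sum_(j < (n - k).+1) \sum_(a | stair k a) F (set_exp a k (inord j)).
Proof.
rewrite pair_big_dep /=.
rewrite (reindex_onto
  (fun p : 'I_(n - k).+1 * {ffun 'I_n.+1 -> 'I_n.+1} =>
     set_exp p.2 k (inord p.1))
  (fun a => (inord (a k), set_exp a k ord0))) => [|a ka]; last first.
  by rewrite /= set_exp_set inordK ?stair_ltn // inord_val set_exp_id.
apply: eq_bigl => -[j a] /=.
have lej := ltn_ord j.
have jE : @inord n j = j :> nat by rewrite inordK //; lia.
apply/andP/idP => [[ka /eqP[_ <-]] | ka]; first exact: stair_set_exp0.
split; first by apply: stair_set_exp => //; rewrite jE -ltnS.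
rewrite set_exp_set set_exp0 //; apply/eqP; congr pair.
by apply/val_inj; rewrite /= ffunE eqxx inordK jE.
Qed.

End Staircase.

(** * The tower of subrings and its spanning monomials *)

Section Tower.
Variables (n : nat) (R : comNzRingType) (S : subringClosed R).
Variable x : 'I_n.+1 -> R.

Fixpoint tower (k : nat) : subringClosed R :=
  if k is k'.+1 then adjoin (tower k') (x (inord k')) else S.

Lemma sub_tower k : {subset S <= tower k}.
Proof. by elim: k => //= k IH p /IH; apply: sub_adjoin. Qed.

Lemma mem_tower (i : 'I_n.+1) k : (i < k)%N -> x i \in tower k.
Proof.
elim: k => //= k IH; rewrite ltnS leq_eqVlt => /orP[/eqP<- | /IH].
  by rewrite inord_val; apply: mem_adjoin.
exact: sub_adjoin.
Qed.

Lemma stairX_tower k a : stair k a -> stairX x a \in tower k.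
Proof.
move=> /forallP ka; apply: rpred_prod => i _.
have [ltik | leki] := ltnP i k; first by rewrite rpredX ?mem_tower.
by have /andP[_] := ka i; rewrite leki => /eqP->; rewrite rpred1.
Qed.

Lemma tower_fixed (tau : {rmorphism R -> R}) k :
    {in S, tau =1 id} -> (forall i : 'I_n.+1, (i < k)%N -> tau (x i) = x i) ->
  (k <= n.+1)%N -> {in tower k, tau =1 id}.
Proof.
move=> tauS; elim: k => //= k IH taux ltkn _ /asboolP[P PS ->].
rewrite -horner_map /= taux ?inordK //; congr (_.[_]).
apply/polyP => i; rewrite coef_map /= IH ?(ltnW ltkn) //; last first.
  exact: (polyOverP PS).
by move=> j ltjk; apply/taux/ltnW.
Qed.

Definition tail_poly k : {poly R} :=
  \prod_(k <= i < n.+1) ('X - (x (inord i))%:P).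

Lemma tail_poly_monic k : tail_poly k \is monic.
Proof. exact: monic_prod_XsubC. Qed.

Lemma size_tail_poly k : size (tail_poly k) = (n.+1 - k).+1.
Proof. by rewrite size_prod_XsubC size_iota. Qed.

Lemma tail_polyS k : (k < n.+1)%N ->
  tail_poly k = tail_poly k.+1 * ('X - (x (inord k))%:P).
Proof. by move=> ltkn; rewrite /tail_poly big_ltn // mulrC. Qed.

Lemma tail_poly0 : tail_poly 0 = \prod_i ('X - (x i)%:P).
Proof.
by rewrite /tail_poly big_mkord; apply: eq_bigr => i _; rewrite inord_val.
Qed.

Hypothesis xS : \prod_i ('X - (x i)%:P) \is a polyOver S.

(** Passing from [k] to [k.+1] divides by a linear factor whose root has just been adjoined. *)
Lemma tail_poly_tower k : (k <= n.+1)%N -> tail_poly k \is a polyOver (tower k).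
Proof.
elim: k => [_|k IH ltkn]; first by rewrite tail_poly0.
apply: (@polyOver_XsubC_factor _ (tower k.+1) _ (x (inord k))).
  exact: mem_adjoin.
rewrite -tail_polyS //; apply: polyOverS (IH (ltnW ltkn)).
exact: sub_adjoin.
Qed.

Lemma tower_span (k : 'I_n.+1) p : p \in tower k.+1 ->
  exists2 g : nat -> R, forall j, g j \in tower k &
    p = \sum_(j < (n - k).+1) g j * x k ^+ j.
Proof.
move=> /asboolP[P PS ->]; rewrite inord_val.
have kroot : root (tail_poly k) (x k).
  by rewrite tail_polyS // inord_val rootE hornerM hornerXsubC subrr mulr0.
have [r [rS ltr ->]] := polyOver_reduce (tail_poly_monic k)
  (tail_poly_tower (ltnW (ltn_ord k))) kroot PS.
exists (nth 0 r) => [j|]; first exact: (polyOverP rS).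
apply: horner_coef_wide; move: ltr; rewrite size_tail_poly subSn ?ltnS //.
by rewrite -ltnS.
Qed.

Lemma stair_span k p : (k <= n.+1)%N -> p \in tower k ->
  exists2 f : {ffun 'I_n.+1 -> 'I_n.+1} -> R, forall a, f a \in S &
    p = \sum_(a | stair k a) f a * stairX x a.
Proof.
elim: k p => [|k IH] p ltkn pk.
  exists (fun=> p) => //; rewrite (big_pred1 [ffun=> ord0]) => [|a].
    by rewrite /stairX big1 ?mulr1 // => i _; rewrite ffunE.
  exact/stair0P/eqP.
have [g gk ->] := @tower_span (Ordinal ltkn) p pk.
have {IH} : forall j, exists f : {ffun 'I_n.+1 -> 'I_n.+1} -> R,
    (forall a, f a \in S) /\ g j = \sum_(a | stair k a) f a * stairX x a.
  by move=> j; have [f fS ->] := IH (g j) (ltnW ltkn) (gk j); exists f.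
move=> /choice[f fP]; pose o := Ordinal ltkn.
(* The exponent of [x o] selects the coefficient [g (a o)]; the remaining exponents select a term of
   its expansion. *)
exists (fun a : {ffun 'I_n.+1 -> 'I_n.+1} => f (a o) (set_exp a o ord0)) => [a|].
  by case: (fP (a o)).
rewrite (big_stair_recr o); apply: eq_bigr => j _.
case: (fP j) => _ ->; rewrite mulr_suml; apply: eq_bigr => a ka.
have jn : (j < n.+1)%N by apply: leq_trans (ltn_ord j) _; rewrite ltnS leq_subr.
rewrite set_exp_set set_exp0 // stairX_set_exp // ffunE eqxx inordK //.
by rewrite mulrA.
Qed.

End Tower.

(** * Linear independence by conjugation *)

Section Independence.
Variables (n : nat) (R : idomainType) (S : subringClosed R).
Variable x : 'I_n.+1 -> R.
Hypothesis x_inj : injective x.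
Hypothesis x_conj : forall k l : 'I_n.+1, exists tau : {rmorphism R -> R},
  {in S, tau =1 id} /\ forall i, tau (x i) = x (tperm k l i).

Lemma tower_free (k : 'I_n.+1) (g : nat -> R) :
    (forall j, g j \in tower S x k) ->
    \sum_(j < (n - k).+1) g j * x k ^+ j = 0 ->
  forall j, (j < (n - k).+1)%N -> g j = 0.
Proof.
move=> gk g0; pose P := \poly_(j < (n - k).+1) g j.
suff P0 : P = 0.
  by move=> j ltj; have := coef_poly (n - k).+1 g j; rewrite ltj -/P P0 coef0.
pose rs := [seq x (inord l) | l <- index_iota k n.+1].
apply/eqP/negPn/negP => nzP.
have rsP : all (root P) rs.
  apply/allP => _ /mapP[l + ->]; rewrite mem_index_iota => /andP[lekl ltln].
  have [tau [tauS taux]] := x_conj k (inord l).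
  rewrite rootE horner_poly; apply/eqP.
  (* [tau] fixes the coefficients, which lie in level [k], and moves [x k] to [x (inord l)]: the
     image of the relation says that the latter is a root too. *)
  rewrite -[RHS](rmorph0 tau) -[in RHS]g0 rmorph_sum.
  apply: eq_bigr => j _.
  rewrite rmorphM rmorphXn /= taux tpermL (tower_fixed tauS _ _ (gk j)) //.
    move=> i ltik; rewrite taux tpermD //.
      by rewrite neq_ltn ltik orbT.
    by rewrite -val_eqE /= inordK //; lia.
  exact/ltnW.
have uniq_rs : uniq rs.
  rewrite map_inj_in_uniq ?iota_uniq // => i j.
  rewrite !mem_index_iota => /andP[_ lti] /andP[_ ltj] /x_inj/(congr1 val).
  by rewrite /= !inordK.
(* There are [n.+1 - k] distinct roots, but the degree is at most [n - k]. *)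
have := leq_trans (max_poly_roots nzP rsP uniq_rs) (size_poly _ _).
by rewrite size_map size_iota subSn ?ltnn // -ltnS.
Qed.

(** Grouped by powers of the last variable, the relation has coefficients in level [k]; these vanish
    by [tower_free], and induction applies to each. *)
Lemma stair_free k (f : {ffun 'I_n.+1 -> 'I_n.+1} -> R) :
    (k <= n.+1)%N -> (forall a, f a \in S) ->
    \sum_(a | stair k a) f a * stairX x a = 0 ->
  forall a, stair k a -> f a = 0.
Proof.
elim: k f => [|k IH] f ltkn fS.
  rewrite (big_pred1 [ffun=> ord0]) => [|a]; last exact/stair0P/eqP.
  rewrite /stairX big1 ?mulr1 => [f0 a /stair0P-> //|i _].
  by rewrite ffunE.
pose o := Ordinal ltkn; rewrite (big_stair_recr o) => f0 a ka.
pose c j a' := f (set_exp a' o (inord j)).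
have c0 j : (j < (n - k).+1)%N -> \sum_(a' | stair k a') c j a' * stairX x a' = 0.
  apply: (@tower_free o (fun j => \sum_(a' | stair k a') c j a' * stairX x a')).
    move=> i; apply: rpred_sum => a' ka'.
    by apply: rpredM; [apply/sub_tower/fS | apply: stairX_tower].
  rewrite -[RHS]f0; apply: eq_bigr => {}j _.
  rewrite mulr_suml; apply: eq_bigr => a' ka'.
  have jn : (j < n.+1)%N by apply: leq_trans (ltn_ord j) _; rewrite ltnS leq_subr.
  by rewrite stairX_set_exp // inordK // mulrA.
have := IH (c (a o)) (ltnW ltkn) (fun a' => fS _) (c0 _ (@stair_ltn _ o a ka))
  _ (@stair_set_exp0 _ o a ka).
by rewrite /c set_exp_set inord_val set_exp_id.
Qed.

End Independence.

(** * The tower over the symmetric polynomials *)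

Section SymmetricPolynomials.
Variable n : nat.
Local Notation P := {mpoly int[n.+1]}.

Lemma msymXU (s : 'S_n.+1) i : msym s ('X_i : P) = 'X_(s i).
Proof.
rewrite msymX; congr mpolyX; apply/mnmP => j; rewrite mnmE !mnm1E.
by rewrite -(inj_eq (@perm_inj _ s)) permKV.
Qed.

Let S : subringClosed P :=
  GRing.SubringClosed.clone P (@symmetric_pred n.+1 int) _.

Let mem_SE p : (p \in S) = (p \is symmetric).
Proof. by []. Qed.

Lemma mpolyC_sym c : c%:MP \in S.
Proof. by rewrite -alg_mpolyC mem_SE rpredZ ?rpred1. Qed.

Lemma prod_XsubXU_sym :
  \prod_(i < n.+1) ('X - ('X_i : P)%:P) \is a polyOver S.
Proof.
rewrite Viete; apply: rpred_sum => k _; apply/polyOverP => i.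
rewrite coefZ coefZ coefXn rpredM ?rpredX ?rpredN ?rpred1 //.
by rewrite rpredM ?rpred_nat ?mem_SE ?mesym_sym.
Qed.

Lemma mpoly_tower (p : P) : p \in tower S (fun i => 'X_i) n.+1.
Proof.
rewrite [p]mpolyE; apply: rpred_sum => m _.
rewrite -mul_mpolyC mpolyXE_id; apply: rpredM; first exact/sub_tower/mpolyC_sym.
by apply: rpred_prod => i _; apply/rpredX/mem_tower.
Qed.

Definition stairXU := @stairX n P (fun i => 'X_i).

Lemma mpoly_stair_span (p : P) :
  exists2 f : {ffun 'I_n.+1 -> 'I_n.+1} -> P, forall a, f a \is symmetric &
    p = \sum_(a | stair n.+1 a) f a * stairXU a.
Proof. exact: (stair_span prod_XsubXU_sym (leqnn _) (mpoly_tower p)). Qed.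

Lemma mpoly_stair_free (f : {ffun 'I_n.+1 -> 'I_n.+1} -> P) :
    (forall a, f a \is symmetric) ->
    \sum_(a | stair n.+1 a) f a * stairXU a = 0 ->
  forall a, stair n.+1 a -> f a = 0.
Proof.
apply: (@stair_free n P S) => // [i j | k l].
  move=> /(congr1 (mcoeff U_(j)%MM)); rewrite !mcoeffX eqxx.
  by case: (_ =P _) => // /mnmP/(_ j); rewrite !mnm1E eqxx; case: (i =P j).
exists (msym (tperm k l)); split=> [p /issymP|i]; first exact.
exact: msymXU.
Qed.

End SymmetricPolynomials.

(** * Descent to the quotient *)

Lemma sl_predP n (r : Rh n) :
  reflect (exists2 p : {mpoly int[n]}, p \is symmetric & r = to_Rh p)
    (r \in @sl_pred n).
Proof.
apply: (iffP idP) => [/asboolP[q ->] | [p psym ->]].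
  eexists; last by [].
  apply: mcomp_sym => i; rewrite -tnth_nth tnth_mktuple; exact: mesym_sym.
(* Fundamental theorem of symmetric polynomials. *)
by apply/asboolP; exists (symf p); rewrite -symfP.
Qed.

Lemma to_Rh_surj n (r : Rh n) : exists p, r = to_Rh p.
Proof. by elim/quotW: r => p; exists p. Qed.

Lemma to_Rh_eq0 n (p : {mpoly int[n]}) :
  to_Rh p = 0 <-> exists q, p = q * torus_rel n.
Proof.
have -> : (to_Rh p = 0) = (to_Rh p == to_Rh 0).
  by rewrite rmorph0; apply/propext; split=> /eqP.
by rewrite eqmodE /= /Quotient.equiv subr0; split=> /asboolP.
Qed.

Theorem mainTheorem1 (n : nat) (hn : (0 < n)%N) :
  @is_free_module (Rsl n) (Rh n) /\
  @is_basis (Rsl n) (Rh n) (staircase n) (@staircase_monomial n).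
Proof.
suff b : @is_basis (Rsl n) (Rh n) (staircase n) (@staircase_monomial n).
  by split=> //; exists (staircase n : eqType), (@staircase_monomial n).
case: n hn => // n _.
have P_stair (a : {ffun 'I_n.+1 -> 'I_n.+1}) :
    [forall i, (a i <= n.+1 - i.+1)%N] = stair n.+1 a.
  by apply: eq_forallb => i; rewrite subSS [(n < i)%N]ltnNge leq_ord andbT.
have monE a : staircase_monomial a = to_Rh (stairXU (val a)).
  rewrite /staircase_monomial rmorph_prod; apply: eq_bigr => i _.
  by rewrite rmorphXn.
have sumE (V : nmodType) (F : {ffun 'I_n.+1 -> 'I_n.+1} -> V) :
    \sum_(a | stair n.+1 a) F a = \sum_(a : staircase n.+1) F (val a).
  by rewrite -big_sub; apply: eq_bigl => a; rewrite -P_stair.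
split=> [m | s c uniq_s].
  have [p ->] := to_Rh_surj m; have [f fsym ->] := mpoly_stair_span p.
  (* The default 0 is never reached, since each [f (val a)] is symmetric. *)
  exists (enum (staircase n.+1)), (fun a => insubd 0 (to_Rh (f (val a)))).
  rewrite big_enum sumE rmorph_sum; apply: eq_bigr => a _.
  rewrite rmorphM monE; congr (_ * _); rewrite insubdK //; apply/sl_predP.
  by exists (f (val a)).
have /choice[f fP] (a : staircase n.+1) : exists p : {mpoly int[n.+1]},
    p \is symmetric /\ Rsl_val (c a) = to_Rh p.
  by have /sl_predP[p] := RslP (c a); exists p.
(* Symmetric lifts of the coefficients, extended by 0 outside [s] and outside the staircase. *)
pose g (a : {ffun 'I_n.+1 -> 'I_n.+1}) : {mpoly int[n.+1]} :=
  if insub a is Some b then if b \in s then f b else 0 else 0.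
have gsym a : g a \is symmetric.
  rewrite /g; case: insub => [b|]; last exact: rpred0.
  by case: ifP => _; [case: (fP b) | exact: rpred0].
have gE (a : staircase n.+1) : g (val a) = if a \in s then f a else 0.
  by rewrite /g valK.
rewrite big_uniq //= big_mkcond /= => c0.
have /to_Rh_eq0[q Eq] : to_Rh (\sum_(a | stair n.+1 a) g a * stairXU a) = 0.
  rewrite sumE rmorph_sum; apply: etrans c0; apply: eq_bigr => a _.
  rewrite rmorphM gE monE; case: ifP => _; last by rewrite rmorph0 mul0r.
  by rewrite -[_ *: _]/(Rsl_val _ * _); case: (fP a) => _ ->.
have [h hsym Eh] := mpoly_stair_span q.
have rsym : torus_rel n.+1 \is symmetric.
  by rewrite rpredB ?rpred1 // -mesymnnE mesym_sym.
(* Both [g a] and [h a * torus_rel n.+1] are symmetric coordinates of [q * torus_rel n.+1], so they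
   agree by independence. *)
have gh : forall a, stair n.+1 a -> g a - h a * torus_rel n.+1 = 0.
  apply: mpoly_stair_free => [a|]; last first.
    under eq_bigr do rewrite mulrBl mulrAC.
    by rewrite sumrB Eq Eh -mulr_suml subrr.
  have hrsym : h a * torus_rel n.+1 \is symmetric by apply: rpredM.
  by apply: rpredB; [exact: gsym | exact: hrsym].
move=> a sa; apply/val_inj => /=; case: (fP a) => _ ->.
have /eqP := gh (val a) (etrans (esym (P_stair _)) (valP a)).
rewrite subr_eq0 gE sa => /eqP->.
by apply/to_Rh_eq0; exists (h (val a)).
Qed.
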